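(* Let $\mathbb{K}$ be a field of characteristic $0$, let $s\ge 1$ be an integer and let $S$ be a finite nonempty subset of $\mathbb{K}$. Let $a_1,\dots,a_s$ be selected at random independently and uniformly from $S$. Then $$\Pr\left[\ \text{for every } e=(e_1,\dots,e_s)\in\mathcal{P}_s,\ \text{the set } \{(x-a_i)^{e_i} : 1\le i\le s\}\ \text{is linearly independent}\ \right]\ \ge\ 1-\frac{f(s)}{|S|},$$ where $$f(s)=\binom{s+\frac{s^2}{2}-1}{s}(s-1)(s-2).$$
   Context: $\mathbb{N}$ contains $0$. A sequence $e=(e_1,\dots,e_s)\in\mathbb{N}^s$ satisfies the Pólya condition if, with $n_i=|\{j : e_j<i\}|$, one has $n_i\le i$ for all integers $i\ge 0$. $\mathcal{P}_s$ denotes the set of non-increasing sequences $e=(e_1,\dots,e_s)\in\mathbb{N}^s$, $e_1\ge\dots\ge e_s$, satisfying the Pólya condition. Families are read as sets of polynomials (a polynomial occurring for several indices is counted once), and linear independence is over $\mathbb{K}$. For real $y$ and a nonnegative integer $s$, $\binom{y}{s}=\frac{y(y-1)\cdots(y-s+1)}{s!}$. *)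

(* Defs.v *)
From HB Require Import structures.
From mathcomp Require Import all_boot all_order all_algebra.
From mathcomp Require Import finmap boolp reals.

Set Implicit Arguments.
Unset Strict Implicit.
Unset Printing Implicit Defensive.

Import Order.TTheory GRing.Theory Num.Theory.
Local Open Scope ring_scope.

Definition polya_condition (s : nat) (e : 'I_s -> nat) : Prop :=
  forall i : nat, (#|[set j : 'I_s | e j < i]| <= i)%N.

(* Exponents are unbounded, so there are infinitely many such sequences. *)
Definition polya_sequence (s : nat) (e : 'I_s -> nat) : Prop :=
  (forall i j : 'I_s, (i <= j)%N -> (e j <= e i)%N) /\ polya_condition e.

(* Stated on a finite set, not on an indexed family: repeated vectors count
   once. Only the values of [c] on [X] matter. *)
Definition linearly_independent (K : fieldType) (V : lmodType K)
    (X : {fset V}) : Prop :=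
  forall c : V -> K,
    \sum_(v <- X) c v *: v = 0 -> forall v : V, v \in X -> c v = 0.

Definition shifted_powers (K : fieldType) (s : nat) (a : 'I_s -> K)
    (e : 'I_s -> nat) : {fset {poly K}} :=
  [fset ('X - (a i)%:P) ^+ e i | i : 'I_s]%fset.

Definition gbinomial (R : realType) (y : R) (s : nat) : R :=
  (\prod_(i < s) (y - i%:R)) / (s`!)%:R.

Definition uniform_prob (R : realType) (T : finType) (E : T -> Prop) : R :=
  #|[set x : T | `[< E x >]]|%:R / #|T|%:R.

Definition polya_bound (R : realType) (s : nat) : R :=
  gbinomial (s%:R + s%:R ^+ 2 / 2%:R - 1) s * (s%:R - 1) * (s%:R - 2%:R).

(* Main.v *)
Require Import Defs.
From HB Require Import structures.
From mathcomp Require Import all_boot all_order all_algebra.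
From mathcomp Require Import finmap boolp reals.
From mathcomp Require Import perm zify ring.

Set Implicit Arguments.
Unset Strict Implicit.
Unset Printing Implicit Defensive.

Import Order.TTheory GRing.Theory Num.Theory.
Local Open Scope ring_scope.

(** The set of exponent sequences is infinite, so the proof has two
    parts: a reduction to boundedly many sequences, and a union bound over them.
    Both rest on the Wronskian of the powers [('X - a_i) ^+ e_i].

    Bounding the exponents ([exponent_bound_of_relation]).  Let the [a_i] be
    distinct and let [n] be an exponent occurring with nonzero coefficient in a
    linear relation, at the point [b].  After discarding terms, [('X - b) ^+ n]
    is a combination of [m < s] linearly independent powers.  In characteristic
    0 their Wronskian is nonzero ([free_wronskian_neq0]).  It is the product of
    large powers of the factors ['X - a_i] with a polynomial of degree at most
    ['C(m, 2)] ([wronskian_powersE], [size_det_leq]).  Replacing one of the [m]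
    powers by [('X - b) ^+ n] only multiplies the Wronskian by a constant, so
    ['X - b] divides it at least [n - (m - 1)] times; as [b] differs from the
    [a_i], the factor of low degree absorbs all of this, whence
    [n < 'C(m + 1, 2) <= 'C(s, 2)].  Consequently, once [s >= 3], a relation for
    [e] is a relation for the truncation of [e] at ['C(s, 2) - 1], and it
    suffices that the Wronskians of the bounded sequences do not vanish
    ([power_family_free_of_bounded]).  The constant sequence [s - 1] is one of
    these, and its Wronskian already forces the [a_i] to be distinct.

    Counting ([card_vanishing_wronskian]).  For a fixed non-increasing [e], the
    Polya condition says that [e_i >= s - 1 - i] with indices from 0.  Expanding
    along the first row shows that the Wronskian, as a function of [a_0], is a
    power of ['X - a_0] times a polynomial of degree at most [s - 1] in
    ['X - a_0], whose constant coefficient is, up to a nonzero scalar, the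
    Wronskian of the remaining [s - 1] powers.  Induction on [s] then bounds the
    number of bad choices by ['C(s, 2) * |S| ^ (s - 1)], exactly as in the
    Schwartz-Zippel lemma.

    There are at most ['C(s + 'C(s, 2) - 1, s)] non-increasing sequences with
    entries below ['C(s, 2)], and the product of the two binomials is at most the
    announced constant when [s >= 3] ([polya_bound_geq]).  For [s <= 2] that
    constant is 0 and independence holds for every choice of the [a_i]
    ([linearly_independent_le2]); this is where repeated polynomials matter. *)

(** * Wronskians and linear independence in characteristic 0 *)

Definition wronskian_mx (K : fieldType) (m : nat) (f : 'I_m -> {poly K}) :
    'M[{poly K}]_m :=
  \matrix_(i, j) (f i)^`(j).

Definition free_family (K : fieldType) (V : lmodType K) (m : nat)
    (f : 'I_m -> V) : Prop :=
  forall c : 'I_m -> K, \sum_i c i *: f i = 0 -> forall i, c i = 0.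

Lemma mulmx_det_neq0 (R : idomainType) (m : nat) (u : 'rV[R]_m) (M : 'M[R]_m) :
  \det M != 0 -> u *m M = 0 -> u = 0.
Proof.
move=> M0 uM; have : u *m (M *m \adj M) = 0 by rewrite mulmxA uM mul0mx.
rewrite mul_mx_adj mul_mx_scalar => /matrixP uE; apply/matrixP => i j.
by have /eqP := uE i j; rewrite !mxE mulf_eq0 (negPf M0) /= => /eqP.
Qed.

(** Cramer's rule for the combination of the rows of the Wronskian matrix that
    yields the derivatives of [\sum_k d k *: f k]: whatever divides all those
    derivatives divides the Wronskian times each coefficient. *)
Lemma wronskian_cramer (K : fieldType) (m : nat) (f : 'I_m -> {poly K})
    (d : 'I_m -> K) (i : 'I_m) :
  (d i)%:P * \det (wronskian_mx f) =
    \sum_(j < m) (\sum_k d k *: f k)^`(j) * \adj (wronskian_mx f) j i.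
Proof.
pose dv : 'rV[{poly K}]_m := \row_k (d k)%:P.
have -> : (d i)%:P * \det (wronskian_mx f) =
    (dv *m (wronskian_mx f *m \adj (wronskian_mx f))) 0 i.
  by rewrite mul_mx_adj mul_mx_scalar !mxE mulrC.
rewrite mulmxA mxE; apply: eq_bigr => j _; congr (_ * _).
rewrite mxE raddf_sum. apply: eq_bigr => k _. 
by rewrite /= !mxE derivnZ mul_polyC.
Qed.

Lemma wronskian_neq0_free (K : fieldType) (m : nat) (f : 'I_m -> {poly K}) :
  \det (wronskian_mx f) != 0 -> free_family f.
Proof.
move=> W0 c c0 i; apply/eqP; rewrite -polyC_eq0.
have := wronskian_cramer f c i; rewrite c0 big1 => [/eqP|j _].
  by rewrite mulf_eq0 (negPf W0) orbF.
by rewrite linear0 mul0r.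
Qed.

Lemma natr_inj_char0 (K : fieldType) (char0 : [pchar K] =i pred0) (x y : nat) :
  x%:R = y%:R :> K -> x = y.
Proof.
wlog xy : x y / (x <= y)%N => [H|].
  by case: (leqP x y) => [/H//|/ltnW/H H' /esym/H'].
move=> /esym/eqP; rewrite -subr_eq0 -natrB //.
by move/pcharf0P: char0 => ->; lia.
Qed.

(** The degree drops by exactly one, because the new leading coefficient is
    multiplied by a nonzero integer. *)
Lemma lead_coef_deriv (K : fieldType) (char0 : [pchar K] =i pred0)
    (p : {poly K}) :
  lead_coef p^`() = lead_coef p *+ (size p).-1.
Proof.
have [p1|p1] := leqP (size p) 1.
  rewrite [p]size1_polyC // derivC lead_coef0 size_polyC.
  by case: eqP; rewrite /= mulr0n.
have p0 : p != 0 by rewrite -size_poly_gt0 (ltn_trans _ p1).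
have cE : p^`()`_(size p).-2 = lead_coef p *+ (size p).-1.
  by rewrite coef_deriv lead_coefE; case: (size p) p1 => [|[]].
suff -> : lead_coef p^`() = p^`()`_(size p).-2 by [].
rewrite lead_coefE; congr (_`_(_)); apply/eqP; rewrite eqn_leq; apply/andP.
have lt := lt_size_deriv p0; split.
  by move: lt p1; move: (size p) (size p^`()) => a b; lia.
suff h : ((size p).-2 < size p^`())%N.
  by move: h; move: (size p) (size p^`()) => a b; lia.
rewrite ltnNge; apply/negP => /(nth_default 0); rewrite cE => /eqP.
rewrite -mulr_natr mulf_eq0 lead_coef_eq0 (negPf p0) /=.
by move/pcharf0P: char0 => ->; move: p1; case: (size p) => [|[]].
Qed.

(** The hypothesis says that the quotient [p / q] has derivative 0. *)
Lemma proportional_of_deriv (K : fieldType) (char0 : [pchar K] =i pred0)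
    (p q : {poly K}) :
  q != 0 -> q * p^`() = q^`() * p -> exists c, p = c *: q.
Proof.
move=> q0.
(* Comparing leading coefficients in the equation identifies the degrees; the
   difference of [p] and the multiple of [q] with the same leading coefficient
   satisfies the same equation, hence is 0. *)
have sizeE r : r != 0 -> q * r^`() = q^`() * r -> size r = size q.
  move=> r0 /(congr1 lead_coef); rewrite !lead_coefM !lead_coef_deriv //.
  rewrite mulrnAr mulrnAl -[LHS]mulr_natr -[RHS]mulr_natr.
  have l0 : lead_coef q * lead_coef r != 0 by rewrite mulf_neq0 ?lead_coef_eq0.
  move=> /(mulfI l0)/(natr_inj_char0 char0); move: r0 q0.
  rewrite -!size_poly_gt0; move: (size r) (size q) => a b; lia.
move=> pE; have [->|p0] := eqVneq p 0; first by exists 0; rewrite scale0r.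
have sp := sizeE p p0 pE.
exists (lead_coef p / lead_coef q); apply/eqP; rewrite -subr_eq0; apply/negPn.
set c := _ / _; apply/negP => r0.
have sr : size (p - c *: q) = size q.
  apply: (sizeE _ r0).
  by rewrite derivB derivZ !mulrBr pE -!scalerAr (mulrC q).
have : (p - c *: q)`_(size q).-1 != 0 by rewrite -sr -lead_coefE lead_coef_eq0.
rewrite coefB coefZ -{1}sp -!lead_coefE divfK ?subrr ?eqxx //.
by rewrite lead_coef_eq0.
Qed.

(** If the Wronskian of [m + 1] polynomials vanishes but that of the first [m]
    does not, the cofactors [v i] of the last column give a linear relation over
    the polynomial ring satisfied by the [f i] and by their first [m]
    derivatives.  Differentiating that relation and eliminating the last term
    gives a relation among the first [m] rows, which is trivial; thus the ratios
    [v i / v ord_max] have derivative 0 and are constants. *)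
Lemma free_wronskian_neq0 (K : fieldType) (char0 : [pchar K] =i pred0) (m : nat)
    (f : 'I_m -> {poly K}) :
  free_family f -> \det (wronskian_mx f) != 0.
Proof.
elim: m f => [|m IHm] f ff; first by rewrite det_mx00 oner_eq0.
pose g (i : 'I_m) := f (widen_ord (leqnSn m) i).
have gf : free_family g.
  move=> c cg i; pose c' (k : 'I_m.+1) :=
    if unlift ord_max k is Some j then c j else 0.
  have wE k : widen_ord (leqnSn m) k = lift ord_max k.
    by apply: val_inj; rewrite /= /bump leqNgt ltn_ord.
  have := ff c' _ (lift ord_max i); rewrite {2}/c' liftK; apply.
  rewrite big_ord_recr /= /c' unlift_none scale0r addr0 -[RHS]cg.
  by apply: eq_bigr => k _; rewrite wE liftK /g wE.
have Wg := IHm g gf; apply/negP => /eqP W0.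
pose v i := cofactor (wronskian_mx f) i ord_max.
have vn : v ord_max != 0.
  rewrite /v /cofactor mulf_neq0 ?signr_eq0 //.
  suff -> : row' ord_max (col' ord_max (wronskian_mx f)) = wronskian_mx g by [].
  apply/matrixP => i j; rewrite !mxE /g /= /bump leqNgt ltn_ord add0n.
  congr (_^`(_)); congr f; apply: val_inj => /=.
  by rewrite /bump leqNgt ltn_ord add0n.
have vW (j : 'I_m.+1) : \sum_i v i * (f i)^`(j) = 0.
  have /matrixP/(_ ord_max j) := mul_adj_mx (wronskian_mx f).
  rewrite W0 !mxE mul0rn => aW; rewrite -[RHS]aW.
  by apply: eq_bigr => i _; rewrite !mxE.
clearbody v; have dvW (j : 'I_m) : \sum_i (v i)^`() * (f i)^`(j) = 0.
  have := congr1 (@deriv K) (vW (widen_ord (leqnSn m) j)).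
  rewrite /= raddf_sum linear0 /=.
  under eq_bigr do rewrite derivM -derivnS.
  rewrite big_split /=; have /= -> := vW (lift ord0 j).
  by rewrite addr0.
pose u i := v ord_max * (v i)^`() - (v ord_max)^`() * v i.
have uW : (\row_i u (widen_ord (leqnSn m) i)) *m wronskian_mx g = 0.
  apply/matrixP => i j; rewrite !mxE.
  have : \sum_i u i * (f i)^`(j) = 0.
    rewrite /u; under eq_bigr do rewrite mulrBl -!mulrA.
    have /= vWj := vW (widen_ord (leqnSn m) j).
    rewrite big_split /= sumrN -!mulr_sumr dvW vWj.
    by rewrite !mulr0 subrr.
  rewrite big_ord_recr /= {2}/u [_^`() * v _]mulrC subrr mul0r addr0 => uf0.
  rewrite -[RHS]uf0.
  by apply: eq_bigr => k _; rewrite !mxE.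
have u0 i : u i = 0.
  have /matrixP uE := mulmx_det_neq0 Wg uW.
  case: (unliftP ord_max i) => [j ->|->]; last by rewrite /u mulrC subrr.
  have := uE 0 j; rewrite !mxE => <-; congr u; apply: val_inj.
  by rewrite /= /bump leqNgt ltn_ord.
have cE i : exists c, v i = c *: v ord_max.
  apply: (proportional_of_deriv char0 vn); apply/eqP; rewrite -subr_eq0.
  exact/eqP/u0.
have [c {}cE] := choice cE.
have c0 : \sum_i c i *: f i = 0.
  have := vW ord0; under eq_bigr do rewrite derivn0 cE -scalerAl scalerAr.
  by rewrite -mulr_sumr => /eqP; rewrite mulf_eq0 (negPf vn) /= => /eqP.
by move: vn; rewrite cE (ff c c0) scale0r eqxx.
Qed.

(** * Wronskians of shifted powers *)

Lemma derivn_XsubC_exp (R : comNzRingType) (c : R) (n j : nat) :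
  (('X - c%:P) ^+ n)^`(j) = ('X - c%:P) ^+ (n - j) *+ n ^_ j.
Proof.
elim: j => [|j IHj]; first by rewrite derivn0 subn0 ffactn0.
rewrite derivnS IHj derivMn deriv_exp derivXsubC mul1r -subnS ffactnSr.
by rewrite -mulrnA mulnC.
Qed.

Definition power_family (K : fieldType) (m : nat) (a : 'I_m -> K)
    (e : 'I_m -> nat) (i : 'I_m) : {poly K} :=
  ('X - (a i)%:P) ^+ e i.

(** What remains of the Wronskian matrix of the powers after dividing row [i] by
    [('X - a i) ^+ (e i - m.-1)].  The truncated subtractions make this right
    when [e i < m.-1] too: nothing is then extracted, and the entries with
    [j > e i] vanish through the falling factorial. *)
Definition reduced_wronskian_mx (K : fieldType) (m : nat) (a : 'I_m -> K)
    (e : 'I_m -> nat) : 'M[{poly K}]_m :=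
  \matrix_(i, j) (('X - (a i)%:P) ^+ (minn (e i) m.-1 - j) *+ e i ^_ j).

Lemma wronskian_powersE (K : fieldType) (m : nat) (a : 'I_m -> K)
    (e : 'I_m -> nat) :
  \det (wronskian_mx (power_family a e)) =
    (\prod_i ('X - (a i)%:P) ^+ (e i - m.-1))
      * \det (reduced_wronskian_mx a e).
Proof.
pose d : 'rV_m := \row_i ('X - (a i)%:P) ^+ (e i - m.-1).
have -> : \prod_i ('X - (a i)%:P) ^+ (e i - m.-1) = \det (diag_mx d).
  by rewrite det_diag; apply: eq_bigr => i _; rewrite mxE.
rewrite -det_mulmx; congr (\det _); apply/matrixP => i j.
rewrite mul_diag_mx !mxE derivn_XsubC_exp.
have [lt|le] := ltnP (e i) j; first by rewrite ffact_small // !mulr0n mulr0.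
rewrite mulrnAr -exprD; congr (_ ^+ _ *+ _).
by have := ltn_ord j; lia.
Qed.

Lemma sum_ord_sub (m : nat) : (\sum_(i < m) (m - i) = 'C(m, 2) + m)%N.
Proof.
elim: m => [|m IHm]; first by rewrite big_ord0.
rewrite big_ord_recl subn0 binS bin1.
by under eq_bigr do rewrite lift0 subSS; rewrite IHm; lia.
Qed.

Lemma size_det_leq (R : idomainType) (m : nat) (Q : 'M[{poly R}]_m) :
  (forall i j, size (Q i j) <= m - j)%N -> (size (\det Q) <= 'C(m, 2).+1)%N.
Proof.
move=> Qs; apply: (leq_trans (size_sum _ _ _)); apply/bigmax_leqP => /= p _.
rewrite size_Msign; apply: (leq_trans (size_poly_prod_leq _ _)).
have : (\sum_i size (Q i (p i)) <= \sum_(i < m) (m - i))%N.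
  rewrite [X in (_ <= X)%N](reindex_perm p); exact: leq_sum.
by rewrite sum_ord_sub card_ord leq_subLR addnS ltnS addnC.
Qed.

(** Divisibility by a power of ['X - b] passes from the derivatives of
    [('X - b) ^+ n] to the Wronskian of the spanning powers, and, since [b] is not
    among the [a i], to the reduced Wronskian, whose degree is at most
    ['C(m, 2)]. *)
Lemma exponent_bound_of_span (K : fieldType) (char0 : [pchar K] =i pred0)
    (m : nat) (a : 'I_m -> K) (e : 'I_m -> nat) (b : K) (n : nat)
    (d : 'I_m -> K) :
  free_family (power_family a e) -> (forall i, a i != b) ->
  ('X - b%:P) ^+ n = \sum_k d k *: power_family a e k ->
  (n < 'C(m.+1, 2))%N.
Proof.
move=> ff ab hE.
have [i di] : exists i, d i != 0.
  apply: contrapT => nd.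
  have h0 : ('X - b%:P) ^+ n = 0.
    rewrite hE big1 // => k _; have [->|dk] := eqVneq (d k) 0.
      by rewrite scale0r.
    by case: nd; exists k.
  by move/eqP: h0; rewrite expf_eq0 polyXsubC_eq0 andbF.
have W0 := free_wronskian_neq0 char0 ff.
have uW : ('X - b%:P) ^+ (n - m.-1) %| \det (wronskian_mx (power_family a e)).
  rewrite -(dvdpZr _ _ di) -mul_polyC wronskian_cramer -hE.
  elim/big_ind: _ => [|p q|j _]; [exact: dvdp0|exact: dvdp_add|].
  apply: dvdp_mulr.
  rewrite derivn_XsubC_exp -mulr_natr; apply: dvdp_mulr.
  by apply: dvdp_exp2l; have := ltn_ord j; lia.
move: uW W0; rewrite wronskian_powersE mulf_eq0 negb_or => uW /andP[_ Q0].
have : ('X - b%:P) ^+ (n - m.-1) %| \det (reduced_wronskian_mx a e).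
  rewrite Gauss_dvdpr // in uW.
  elim/big_ind: _ => [|p q hp hq|k _]; first exact: coprimep1.
    by rewrite coprimepMr hp.
  apply/coprimep_expl/coprimep_expr/coprimep_XsubC2.
  by rewrite subr_eq0.
move=> /(dvdp_leq Q0); rewrite size_exp_XsubC => /leq_trans-/(_ 'C(m, 2).+1).
have Qs : (size (\det (reduced_wronskian_mx a e)) <= 'C(m, 2).+1)%N.
  apply: size_det_leq => k j; rewrite mxE -mulr_natr -polyC_natr mulrC mul_polyC.
  apply: (leq_trans (size_scale_leq _ _)); rewrite size_exp_XsubC.
  by have := ltn_ord j; lia.
by move=> /(_ Qs); rewrite binS bin1; have := ltn_ord i; lia.
Qed.

(** Among the relations involving [i0], one of minimal support expresses the
    power at [i0] through linearly independent other powers: a relation among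
    those could be subtracted to shrink the support while keeping [i0]. *)
Lemma exponent_bound_of_relation (K : fieldType) (char0 : [pchar K] =i pred0)
    (s : nat) (a : 'I_s -> K) (e : 'I_s -> nat) (c : 'I_s -> K) (i0 : 'I_s) :
  injective a -> \sum_i c i *: power_family a e i = 0 -> c i0 != 0 ->
  (e i0 < 'C(s, 2))%N.
Proof.
move=> a_inj.
have [n] := ubnP #|[set i | c i != 0]|; elim: n c => // n IHn c lt_n c_rel ci0.
pose J := [set i | c i != 0] :\ i0.
have [[d [d_rel dJ [j dj]]]|minJ] := pselect (exists d : 'I_s -> K,
    [/\ \sum_i d i *: power_family a e i = 0,
        forall i, i \notin J -> d i = 0 & exists j, d j != 0]).
  have jJ : j \in J by apply: contraNT dj => /dJ ->.
  have di0 : d i0 = 0 by apply: dJ; rewrite !inE eqxx.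
  apply: (IHn (fun i => c i - c j / d j * d i)).
  - rewrite -ltnS; apply: leq_trans lt_n; rewrite ltnS; apply: proper_card.
    apply/properP; split.
      apply/subsetP => i; rewrite !inE; apply: contra => /eqP ci.
      have -> : d i = 0 by apply: dJ; rewrite !inE ci eqxx andbF.
      by rewrite ci mulr0 subr0.
    exists j; first by move: jJ; rewrite !inE => /andP[].
    by rewrite inE divfK // subrr eqxx.
  - under eq_bigr do rewrite scalerBl -scalerA.
    by rewrite big_split /= sumrN -scaler_sumr c_rel d_rel scaler0 subr0.
  - by rewrite di0 mulr0 subr0.
pose a' (k : 'I_#|J|) := a (enum_val k); pose e' (k : 'I_#|J|) := e (enum_val k).
have free_J : free_family (power_family a' e').
  move=> d d_rel k; apply/eqP/negPn/negP => dk; case: minJ.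
  exists (fun i => \sum_(l | enum_val l == i) d l); split.
  - under eq_bigr do rewrite scaler_suml.
    rewrite -[RHS]d_rel [RHS](partition_big enum_val xpredT) //=.
    by apply: eq_bigr => i _; apply: eq_bigr => l /eqP <-.
  - move=> i iJ; rewrite big_pred0 // => l; apply/negP => /eqP li.
    by move: iJ; rewrite -li enum_valP.
  - exists (enum_val k); rewrite (big_pred1 k) // => l.
    exact: (inj_eq enum_val_inj).
have span : ('X - (a i0)%:P) ^+ e i0 =
    \sum_k (- (c (enum_val k) / c i0)) *: power_family a' e' k.
  have -> : \sum_k (- (c (enum_val k) / c i0)) *: power_family a' e' k =
      \sum_(i in J) (- (c i / c i0)) *: power_family a e i.
    by rewrite [RHS]big_enum_val.
  apply/eqP; rewrite -subr_eq0; apply/eqP.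
  rewrite -sumrN; under eq_bigr do rewrite -scaleNr opprK mulrC -scalerA.
  rewrite -scaler_sumr -[X in X + _](scalerK ci0) -scalerDr.
  rewrite [X in c i0 *: X]/(power_family a e i0).
  have <- : \sum_i c i *: power_family a e i =
      c i0 *: power_family a e i0 + \sum_(i in J) c i *: power_family a e i.
    rewrite (bigD1 i0) //=; congr (_ + _); rewrite [LHS]big_mkcond.
    rewrite [RHS]big_mkcond; apply: eq_bigr => i _; rewrite !inE.
    by case: eqP => //= _; case: eqP => //= ->; rewrite scale0r.
  by rewrite c_rel scaler0.
have J_lt : (#|J| < s)%N.
  rewrite -[X in (_ < X)%N](card_ord s) -cardsT; apply: proper_card.
  by rewrite properE subsetT; apply/subsetPn; exists i0; rewrite !inE ?eqxx.
apply: leq_trans (leq_bin2l 2 J_lt).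
apply: (exponent_bound_of_span char0 free_J _ span) => k.
apply: contraTneq (enum_valP k) => /a_inj ->; by rewrite !inE eqxx.
Qed.

(** * Counting the choices of points with vanishing Wronskian *)

(** The bound of the Schwartz-Zippel lemma, obtained row by row.  The hypothesis
    on [e] makes the anti-diagonal of the Wronskian matrix nonzero, and it is
    inherited by the sequence [e'] without its first term. *)
Lemma card_vanishing_wronskian (K : fieldType) (char0 : [pchar K] =i pred0)
    (T : finType) (v : T -> K) (m : nat) (e : 'I_m -> nat) :
  injective v -> (forall i : 'I_m, m <= e i + i + 1)%N ->
  (#|[set a : {ffun 'I_m -> T} |
      \det (wronskian_mx (power_family (v \o a) e)) == 0%R]|
   <= 'C(m, 2) * #|T| ^ m.-1)%N.
Proof.
move=> v_inj; elim: m e => [|m IHm] e le_e.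
  rewrite (_ : [set _ | _] = finset.set0) ?cards0 //.
  by apply/setP => a; rewrite !inE det_mx00 oner_eq0.
pose e' (i : 'I_m) := e (lift ord0 i).
pose tail (a : {ffun 'I_m.+1 -> T}) : {ffun 'I_m -> T} :=
  [ffun i => a (lift ord0 i)].
pose vanish n (f : 'I_n -> nat) (a : {ffun 'I_n -> T}) :=
  \det (wronskian_mx (power_family (v \o a) f)) == 0.
have le_e' (i : 'I_m) : (m <= e' i + i + 1)%N.
  by have := le_e (lift ord0 i); rewrite lift0 /e'; lia.
(* The cofactors of the first row depend on the other points only. *)
pose cof (a' : {ffun 'I_m -> T}) (j : 'I_m.+1) : {poly K} :=
  (-1) ^+ j * \det (\matrix_(i, k) (power_family (v \o a') e' i)^`(lift j k)).
pose P a' : {poly {poly K}} :=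
  \sum_(j < m.+1) (cof a' j *+ e ord0 ^_ j) *: 'X^(m - j).
(* [P (tail a)] is a polynomial over [{poly K}], evaluated at ['X - a_0]: the
   first row consists of multiples of the powers of that element with exponents
   [e_0 - j], from which the common factor of exponent [e_0 - m] is extracted. *)
have PE (a : {ffun 'I_m.+1 -> T}) :
    \det (wronskian_mx (power_family (v \o a) e)) =
    ('X - (v (a ord0))%:P) ^+ (e ord0 - m) * (P (tail a)).['X - (v (a ord0))%:P].
  rewrite (expand_det_row _ ord0) horner_sum mulr_sumr; apply: eq_bigr => j _.
  rewrite hornerZ hornerXn mxE derivn_XsubC_exp.
  have -> : cofactor (wronskian_mx (power_family (v \o a) e)) ord0 j =
      cof (tail a) j.
    rewrite /cofactor /cof add0n; congr (_ * \det _); apply/matrixP => i k.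
    by rewrite !mxE /power_family /= ffunE.
  have -> : (e ord0 - j = (e ord0 - m) + (m - j))%N.
    by have := le_e ord0; have := ltn_ord j; rewrite /=; lia.
  by rewrite exprD !mulrnAl !mulrnAr; congr (_ *+ _); ring.
(* The constant coefficient of [P a'] comes from the last column, whose
   cofactor is the Wronskian of the remaining powers. *)
have P0 a' : ~~ vanish m e' a' -> P a' != 0.
  move=> na'; apply/eqP => /(congr1 (fun p : {poly {poly K}} => p.[0])).
  rewrite horner0 horner_sum big_ord_recr /= big1 => [|j _]; last first.
    rewrite hornerZ hornerXn expr0n; case: eqP => [|_]; last by rewrite mulr0.
    by have := ltn_ord j; lia.
  rewrite add0r hornerZ hornerXn subnn expr0 mulr1 => /eqP.
  rewrite -mulr_natr mulf_eq0 -polyC_natr polyC_eq0.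
  move/pcharf0P: char0 => ->; rewrite -[_ == 0%N]negbK -lt0n ffact_gt0.
  have -> : (m <= e ord0)%N by have := le_e ord0; rewrite /=; lia.
  rewrite orbF mulf_eq0 signr_eq0 /=; apply/negP.
  suff -> : \matrix_(i, k) (power_family (v \o a') e' i)^`(lift ord_max k) =
      wronskian_mx (power_family (v \o a') e') by [].
  by apply/matrixP => i k; rewrite !mxE /= /bump leqNgt ltn_ord.
pose fiber (a' : {ffun 'I_m -> T}) : {set {ffun 'I_m.+1 -> T}} :=
  [set a | vanish m.+1 e a & tail a == a'].
have fiberE a b : tail a = tail b -> a ord0 = b ord0 -> a = b.
  move=> tab ab; apply/ffunP => i; case: (unliftP ord0 i) => [j ->|->] //.
  by have := congr1 (fun f : {ffun 'I_m -> T} => f j) tab; rewrite !ffunE.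
pose hd (a : {ffun 'I_m.+1 -> T}) := a ord0.
have fiber_inj a' : {in fiber a' &, injective hd}.
  move=> a b; rewrite !inE => /andP[_ /eqP ta] /andP[_ /eqP tb] ab.
  by apply: fiberE ab; rewrite ta tb.
(* Over a nonvanishing tail, distinct first points give distinct roots of the
   nonzero polynomial [P a']. *)
have fiber_leq a' : (#|fiber a'| <= if vanish m e' a' then #|T| else m)%N.
  case: ifPn => [_|/P0 Pa'].
    by rewrite -(card_in_imset (@fiber_inj a')) max_card.
  pose rs := [seq 'X - (v (a ord0))%:P | a : {ffun 'I_m.+1 -> T} in fiber a'].
  have -> : #|fiber a'| = size rs by rewrite size_image.
  have size_P : (size (P a') <= m.+1)%N.
    apply: (leq_trans (size_sum _ _ _)); apply/bigmax_leqP => j _.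
    by apply: (leq_trans (size_scale_leq _ _)); rewrite size_polyXn; lia.
  rewrite -ltnS; apply: leq_trans size_P; apply: max_poly_roots => //.
    apply/allP => _ /imageP[a a_fib ->]; move: a_fib; rewrite inE.
    move=> /andP[]; rewrite /vanish PE mulf_eq0 expf_eq0 polyXsubC_eq0 andbF /=.
    by move=> + /eqP <-.
  rewrite map_inj_in_uniq ?enum_uniq // => a b; rewrite !mem_enum => ha hb.
  move=> /(congr1 (fun p : {poly K} => p`_0)); rewrite !coefB !coefC !coefX /=.
  by move=> /addrI/oppr_inj/v_inj; apply: fiber_inj ha hb.
have -> : #|[set a | vanish m.+1 e a]| = (\sum_a' #|fiber a'|)%N.
  rewrite -sum1_card (partition_big tail xpredT) //=; apply: eq_bigr => a' _.
  by rewrite -sum1_card; apply: eq_bigl => a; rewrite !inE.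
apply: (leq_trans (leq_sum _ (fun a' _ => fiber_leq a'))).
rewrite (bigID (vanish m e')) /=.
rewrite (eq_bigr (fun=> #|T|)) => [|a' ->] //.
rewrite [X in (_ + X)%N](eq_bigr (fun=> m)) => [|a' /negPf->] //.
rewrite !sum_nat_const binS bin1 mulnDl; apply: leq_add.
  have := IHm e' le_e'; rewrite cardsE => /(leq_mul (leqnn #|T|)).
  rewrite mulnC => /leq_trans; apply; rewrite mulnCA -expnS.
  by case: (m).
rewrite mulnC leq_mul2l; apply/orP; right; apply: (leq_trans (max_card _)).
by rewrite card_ffun card_ord.
Qed.

(** * Independence of the sets of shifted powers *)

Lemma free_family_inj (K : fieldType) (V : lmodType K) (m : nat)
    (f : 'I_m -> V) :
  free_family f -> injective f.
Proof.
move=> ff i j fij; apply/eqP/negPn/negP => nij.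
pose c k : K := (k == i)%:R - (k == j)%:R.
have /(ff c)/(_ i)/eqP : \sum_k c k *: f k = 0.
  under eq_bigr do rewrite scalerBl.
  have sumE l : \sum_(k < m) (k == l)%:R *: f k = f l.
    rewrite (bigD1 l) //= eqxx scale1r big1 ?addr0 // => k /negPf->.
    by rewrite scale0r.
  by rewrite big_split /= sumrN !sumE fij subrr.
by rewrite /c eqxx (negPf nij) subr0 oner_eq0.
Qed.

Lemma linearly_independent_image (K : fieldType) (V : lmodType K) (m : nat)
    (f : 'I_m -> V) :
  free_family f -> linearly_independent [fset f i | i : 'I_m]%fset.
Proof.
move=> ff c; have f_inj := free_family_inj ff.
rewrite big_imfset /=; last by move=> i j _ _; apply: f_inj.
rewrite (perm_big (index_enum 'I_m)) /=; last first.
  apply: uniq_perm; rewrite ?enum_uniq ?index_enum_uniq // => i.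
  by rewrite mem_enum mem_index_enum.
by move=> /(ff (c \o f)) c0 v /imfsetP[i _ ->]; apply: c0.
Qed.

Lemma linearly_independent1 (K : fieldType) (V : lmodType K) (v : V) :
  v != 0 -> linearly_independent [fset v]%fset.
Proof.
move=> v0 c; rewrite big_seq_fset1 => /eqP.
by rewrite scaler_eq0 (negPf v0) orbF => /eqP cv w; rewrite inE => /eqP ->.
Qed.

Lemma power_family_neq0 (K : fieldType) (m : nat) (a : 'I_m -> K)
    (e : 'I_m -> nat) (i : 'I_m) : power_family a e i != 0.
Proof. by rewrite expf_eq0 polyXsubC_eq0 andbF. Qed.

Lemma card_ord_geq (s i : nat) : #|[set j : 'I_s | i <= j]%N| = (s - i)%N.
Proof.
rewrite -sum1_card; under eq_bigl do rewrite inE.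
by rewrite -(big_geq_mkord _ _ xpredT (fun=> 1%N)) sum_nat_const_nat muln1.
Qed.

(** The indices [j >= i] all have [e j < (e i).+1], and there are [s - i] of
    them. *)
Lemma polya_leq (s : nat) (e : 'I_s -> nat) (i : 'I_s) :
  polya_sequence e -> (s <= e i + i + 1)%N.
Proof.
move=> [e_mono e_polya].
have : (#|[set j : 'I_s | i <= j]%N| <= (e i).+1)%N.
  apply: leq_trans (e_polya (e i).+1); apply/subset_leq_card/subsetP => j.
  by rewrite !inE ltnS; apply: e_mono.
by rewrite card_ord_geq leq_subLR; lia.
Qed.

(** Two powers with distinct centres are handled by the exponent bound, since
    the Polya condition makes one exponent positive; two powers with the same
    centre differ in degree or coincide, and then form a singleton. *)
Lemma linearly_independent_le2 (K : fieldType) (char0 : [pchar K] =i pred0)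
    (s : nat) (a : 'I_s -> K) (e : 'I_s -> nat) :
  (s <= 2)%N -> polya_sequence e -> linearly_independent (shifted_powers a e).
Proof.
move=> s2 e_polya.
have [f_inj|] := pselect (injective (power_family a e)).
  apply: linearly_independent_image => c c_rel.
  have c_single i : (forall j, j != i -> c j = 0) -> c i = 0.
    move=> cj; move: c_rel; rewrite (bigD1 i) //= big1 => [|j /cj ->].
      move=> /eqP; rewrite addr0 scaler_eq0 (negPf (power_family_neq0 _ _ _)).
      by rewrite orbF => /eqP.
    by rewrite scale0r.
  have [a_inj|a_ninj] := pselect (injective a).
    have c0 i : (0 < e i)%N -> c i = 0.
      move=> ei; apply/eqP/negPn/negP => ci.
      have := leq_trans (exponent_bound_of_relation char0 a_inj c_rel ci)
        (leq_bin2l 2 s2).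
      by rewrite binn; lia.
    move=> i; case: (posnP (e i)) => [ei0|]; last exact: c0.
    apply: c_single => j nji; apply: c0.
    have := polya_leq i e_polya; have := polya_leq j e_polya.
    have : (j != i :> nat)%N := nji.
    have := ltn_ord i; have := ltn_ord j; lia.
  have [i [j [aij nij]]] : exists i j, a i = a j /\ i <> j.
    apply: contrapT => h; apply: a_ninj => i j aij.
    by apply: contrapT => nij; apply: h; exists i, j.
  have other k : k = i \/ k = j.
    have [->|nki] := eqVneq k i; first by left.
    right; apply: val_inj => /=.
    have : (i != j :> nat)%N by apply/eqP => /val_inj.
    have : (k != i :> nat)%N := nki.
    have := ltn_ord i; have := ltn_ord j; have := ltn_ord k; lia.
  have sizes : c i != 0 -> c j != 0 -> False.
    move=> ci cj; move: c_rel; rewrite (bigD1 i) //= (big_pred1 j) => [|k].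
      move=> /eqP; rewrite addr_eq0 -scaleNr => /eqP.
      move=> /(congr1 (fun p : {poly K} => size p)).
      rewrite !size_scale ?oppr_eq0 // !size_exp_XsubC => -[eij].
      by apply: nij; apply: f_inj; rewrite /power_family aij eij.
    case: (other k) => ->; rewrite /= ?eqxx; first by apply/esym/negbTE/eqP.
    by apply/negP => /eqP ji; apply: nij.
  have [ci|ci] := eqVneq (c i) 0.
    have cj : c j = 0.
      by apply: c_single => k; case: (other k) => -> //; rewrite eqxx.
    by move=> k; case: (other k) => ->.
  have [cj|/(sizes ci)//] := eqVneq (c j) 0.
  move: ci; rewrite c_single ?eqxx // => k.
  by case: (other k) => -> //; rewrite eqxx.
move=> f_ninj.
have [i fi] : exists i, forall j, power_family a e j = power_family a e i.
  apply: contrapT => h; apply: f_ninj => i j fij.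
  apply: contrapT => nij; apply: h; exists i => k.
  have [->//|nki] := eqVneq k i; rewrite fij; congr (power_family _ _ _).
  apply: val_inj => /=.
  have : (i != j :> nat)%N by apply/eqP => /val_inj.
  have : (k != i :> nat)%N := nki.
  have := ltn_ord i; have := ltn_ord j; have := ltn_ord k; lia.
suff -> : shifted_powers a e = [fset power_family a e i]%fset.
  exact/linearly_independent1/power_family_neq0.
apply/fsetP => v; rewrite inE; apply/imfsetP/eqP => [[j _ ->]|->].
  exact: fi.
by exists i.
Qed.

(** Truncating the exponents at ['C(s, 2) - 1 >= s - 1] keeps the sequence
    non-increasing and keeps the lower bounds on its terms, and by
    [exponent_bound_of_relation] it changes no power that occurs in a
    relation. *)
Lemma power_family_free_of_bounded (K : fieldType)
    (char0 : [pchar K] =i pred0) (s : nat) (a : 'I_s -> K) :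
  (2 < s)%N ->
  (forall e : 'I_s -> nat, (forall i j : 'I_s, (i <= j)%N -> (e j <= e i)%N) ->
     (forall i : 'I_s, s <= e i + i + 1)%N -> (forall i, e i < 'C(s, 2))%N ->
     \det (wronskian_mx (power_family a e)) != 0) ->
  forall e, polya_sequence e -> free_family (power_family a e).
Proof.
move=> s3 good e e_polya c c_rel.
have s_leq : (s <= 'C(s, 2))%N.
  by case: (s) s3 => // t t2; rewrite binS bin1 -addn1 addnC leq_add2r bin_gt0.
(* The constant sequence [s.-1] satisfies the conditions, and equal points would
   give it equal powers. *)
have a_inj : injective a.
  have /wronskian_neq0_free/free_family_inj f_inj :
      \det (wronskian_mx (power_family a (fun=> s.-1))) != 0.
    by apply: good => // i; have := ltn_ord i; lia.
  by move=> i j aij; apply: f_inj; rewrite /power_family aij.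
have [e_mono _] := e_polya.
pose e' i := minn (e i) 'C(s, 2).-1.
have /wronskian_neq0_free free_e' :
    \det (wronskian_mx (power_family a e')) != 0.
  apply: good => [i j /e_mono|i|i]; rewrite /e'.
  - lia.
  - by have := polya_leq i e_polya; lia.
  - lia.
apply: free_e'; rewrite -[RHS]c_rel; apply: eq_bigr => i _.
have [->|ci] := eqVneq (c i) 0; first by rewrite !scale0r.
have := exponent_bound_of_relation char0 a_inj c_rel ci.
by rewrite /power_family /e' => ei; rewrite (minn_idPl _) //; lia.
Qed.

(** * The union bound *)

(** With [n = s + 'C(s, 2) - 1] the generalized binomial has its top argument at
    [n + s / 2], so its factors dominate those of ['C(n, s)].  For [s = 3] this
    alone does not absorb the factor ['C(s, 2)]; but the last factor grows from
    ['C(s, 2)] to ['C(s, 2) + s / 2], a ratio of [s / (s - 1)], which closes the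
    gap. *)
Lemma polya_bound_geq (R : realType) (s : nat) : (2 < s)%N ->
  ('C(s + 'C(s, 2).-1, s) * 'C(s, 2))%:R <= polya_bound R s.
Proof.
move=> s3; rewrite /polya_bound /gbinomial.
have sf : 0 < (s`!)%:R :> R by rewrite ltr0n fact_gt0.
set n := (s + 'C(s, 2).-1)%N.
have N0 : (0 < 'C(s, 2))%N by rewrite bin_gt0 ltnW.
have nE : n%:R = s%:R + 'C(s, 2)%:R - 1 :> R.
  by rewrite /n natrD -[in RHS](prednK N0) -[in RHS]addn1 natrD addrA addrK.
have NE : 'C(s, 2)%:R = s%:R * (s%:R - 1) / 2 :> R.
  have : (2 * 'C(s, 2) = s * s.-1)%N by rewrite -mul_bin_diag bin1.
  move=> /(congr1 (fun k => k%:R : R)); rewrite !natrM.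
  by rewrite -(natrB _ (_ : 1 <= s)%N) ?subn1; [move=> <-; field | lia].
have yE : s%:R + s%:R ^+ 2 / 2 - 1 = n%:R + s%:R / 2 :> R.
  by rewrite nE NE; field.
rewrite yE -!mulrA mulrCA natrM.
have -> : 'C(n, s)%:R = (\prod_(i < s) (n%:R - i%:R)) / (s`!)%:R :> R.
  apply: (mulIf (lt0r_neq0 sf)); rewrite divfK ?lt0r_neq0 //.
  rewrite -natrM bin_ffact ffact_prod natr_prod; apply: eq_bigr => i _.
  by rewrite natrB // /n; have := ltn_ord i; lia.
rewrite mulrAC [X in X <= _]mulrC ler_pM2l ?invr_gt0 //.
case: s s3 @n sf N0 nE NE yE => // s s2 n sf N0 nE NE yE.
rewrite !big_ord_recr /=.
have ge0 (i : 'I_s) : 0 <= n%:R - i%:R :> R.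
  by rewrite subr_ge0 ler_nat /n; have := ltn_ord i; lia.
have le_prod : \prod_(i < s) (n%:R - i%:R) <=
    \prod_(i < s) (n%:R + s.+1%:R / 2 - i%:R) :> R.
  apply: ler_prod => i _; rewrite ge0 /= lerB // lerDl divr_ge0 //.
have -> : n%:R - s%:R = 'C(s.+1, 2)%:R :> R by rewrite nE -natr1; ring.
have -> : n%:R + s.+1%:R / 2 - s%:R = 'C(s.+1, 2)%:R + s.+1%:R / 2 :> R.
  by rewrite nE -natr1; ring.
rewrite -!mulrA; apply: ler_pM => //.
- exact: prodr_ge0.
- by rewrite mulr_ge0.
have s2' : 2 <= s%:R :> R by rewrite ler_nat.
rewrite NE -natr1 -subr_ge0; set x : R := s%:R.
rewrite [leRHS](_ : _ = (x + 1) ^+ 2 * x / 4 * (x - 2)); last by field.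
by rewrite !mulr_ge0 ?invr_ge0 ?subr_ge0 ?ler0n ?addr_ge0.
Qed.

(** Non-increasing sequences are counted as sorted tuples read backwards. *)
Lemma card_vanishing_bounded (K : fieldType) (char0 : [pchar K] =i pred0)
    (T : finType) (v : T -> K) (s N : nat) :
  injective v ->
  exists B : {set {ffun 'I_s -> T}},
    (#|B| <= 'C(s + N, s) * ('C(s, 2) * #|T| ^ s.-1))%N /\
    forall a : {ffun 'I_s -> T}, a \notin B ->
    forall e : 'I_s -> nat, (forall i j : 'I_s, (i <= j)%N -> (e j <= e i)%N) ->
      (forall i : 'I_s, s <= e i + i + 1)%N -> (forall i, e i < N.+1)%N ->
      \det (wronskian_mx (power_family (v \o a) e)) != 0.
Proof.
move=> v_inj.
pose ex (t : s.-tuple 'I_N.+1) (i : 'I_s) : nat := tnth t (rev_ord i).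
pose E := [set t : s.-tuple 'I_N.+1 | sorted leq (map val t)].
pose adm (t : s.-tuple 'I_N.+1) := [forall i : 'I_s, s <= ex t i + i + 1]%N.
pose bad t := [set a : {ffun 'I_s -> T} |
  \det (wronskian_mx (power_family (v \o a) (ex t))) == 0].
exists (\bigcup_(t in E | adm t) bad t); split.
  rewrite -card_sorted_tuples -sum_nat_const.
  apply: (@leq_trans (\sum_(t in E | adm t) #|bad t|)).
    elim/big_rec2: _ => [|t n B _ le_n]; first by rewrite cards0.
    by rewrite (leq_trans (leq_card_setU _ _)) // leq_add2l.
  rewrite big_mkcondr; apply: leq_sum => t _; case: ifP => // /forallP t_adm.
  exact: card_vanishing_wronskian.
move=> a aB e e_mono le_e lt_e; apply: contraNneq aB => W0.
pose t := [tuple inord (e (rev_ord i)) | i < s] : s.-tuple 'I_N.+1.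
have exE : ex t = e.
  by apply/funext => i; rewrite /ex tnth_mktuple inordK // rev_ordK.
apply/bigcupP; exists t; last by rewrite inE exE W0.
apply/andP; split; last by apply/forallP => i; rewrite exE.
rewrite inE; apply/(sortedP 0%N) => i; rewrite size_map size_tuple => lt_i.
have nthE k (lt_k : (k < s)%N) : nth 0%N (map val t) k = e (rev_ord (Ordinal lt_k)).
  rewrite (nth_map ord0) ?size_tuple // -(tnth_nth _ _ (Ordinal lt_k)).
  by rewrite tnth_mktuple /= inordK.
by rewrite (nthE _ lt_i) (nthE _ (ltnW lt_i)); apply: e_mono => /=; lia.
Qed.

Lemma uniform_prob_geq (R : realType) (T : finType) (P : T -> Prop)
    (B : {set T}) : (0 < #|T|)%N ->
  (forall x, x \notin B -> P x) -> 1 - #|B|%:R / #|T|%:R <= uniform_prob R P.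
Proof.
move=> T0 BP; have T0' : 0 < #|T|%:R :> R by rewrite ltr0n.
rewrite /uniform_prob ler_pdivlMr // mulrBl mul1r divfK ?lt0r_neq0 //.
rewrite lerBlDr -natrD ler_nat -(cardsC B) addnC leq_add2r.
apply/subset_leq_card/subsetP => x; rewrite !inE => /BP Px; exact/asboolP.
Qed.

(* Independent uniform choices from S are a uniform element of S^s. *)
Theorem theorem3p13 (R : realType) (K : fieldType)
    (char0 : [pchar K] =i pred0) (s : nat) (s_ge1 : (1 <= s)%N)
    (S : {fset K}) (S_neq0 : S != fset0) :
  uniform_prob R (fun a : {ffun 'I_s -> S} =>
    forall e : 'I_s -> nat, polya_sequence e ->
      linearly_independent (shifted_powers (fun i => val (a i)) e))
  >= 1 - polya_bound R s / #|` S|%:R.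
Proof.
have S0 : (0 < #|{: S}|)%N by rewrite -cardfE cardfs_gt0.
have T0 : (0 < #|{: {ffun 'I_s -> S}}|)%N by rewrite card_ffun expn_gt0 S0.
have S0' : 0 < #|{: S}|%:R :> R by rewrite ltr0n.
rewrite cardfE; have [s2|s3] := leqP s 2.
  have -> : polya_bound R s = 0.
    rewrite /polya_bound; move: s_ge1 s2; case: (s) => [|[|[|]]] // _ _.
      by rewrite subrr mulr0 mul0r.
    by rewrite subrr mulr0.
  rewrite mul0r subr0; apply: le_trans (uniform_prob_geq (B := finset.set0) _ T0 _).
    by rewrite cards0 mul0r subr0.
  by move=> a _ e; apply: linearly_independent_le2.
have [B [le_B good]] :=
  @card_vanishing_bounded K char0 S val s 'C(s, 2).-1 val_inj.
apply: le_trans (uniform_prob_geq (B := B) _ T0 _); last first.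
  move=> a aB e e_polya; apply: linearly_independent_image.
  apply: (power_family_free_of_bounded char0 s3) e_polya => e' e'_mono le_e' lt_e'.
  apply: (good a aB e' e'_mono le_e') => i.
  by have := lt_e' i; lia.
rewrite lerB // ler_pdivrMr ?ltr0n //.
apply: (@le_trans _ _ ('C(s + 'C(s, 2).-1, s) * ('C(s, 2) * #|{: S}| ^ s.-1))%:R).
  by rewrite ler_nat.
rewrite card_ffun card_ord.
have -> : (#|{: S}| ^ s = #|{: S}| * #|{: S}| ^ s.-1)%N.
  by rewrite -expnS prednK.
rewrite [in leRHS]natrM mulrA divfK ?lt0r_neq0 // mulnA natrM ler_wpM2r ?ler0n //.
exact: polya_bound_geq.
Qed.
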